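(* Let $G$ be a subgroup of the symmetric group $S_m$, let $U$ be a unitary space, let $\mathfrak{X}$ be an irreducible unitary representation of $G$ over $U$, and let $\chi$ be the irreducible character of $G$ corresponding to $\mathfrak{X}$. For $p\in\{1,2,\dots,m\}$ let $G_p$ be the stabilizer of $p$ in $G$ and let $$T_p=\frac{1}{|G_p|}\sum_{\sigma\in G_p}\mathfrak{X}(\sigma):U\to U.$$ Then: (a) the linear map $T_p$ is an orthogonal projection on $U$; (b) $\operatorname{rank} T_p=\frac{1}{|G_p|}\sum_{\sigma\in G_p}\chi(\sigma)$.
   Context: A unitary space is a finite-dimensional complex vector space equipped with an inner product. A unitary representation of $G$ over $U$ is a group homomorphism from $G$ to the unitary operators on $U$. The character corresponding to $\mathfrak{X}$ is $\chi(\sigma)=\operatorname{tr}\mathfrak{X}(\sigma)$. *)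

(* Defs.v *)
From HB Require Import structures.
From mathcomp Require Import all_boot all_order all_algebra all_fingroup.
From mathcomp Require Import sesquilinear.
From mathcomp Require Import reals complex.

Set Implicit Arguments.
Unset Strict Implicit.
Unset Printing Implicit Defensive.

Import GRing.Theory Num.Theory passmx.
Local Open Scope ring_scope.

Section LinearMaps.
Variables (F : fieldType) (U : vectType F).

Definition lfun_trace (f : 'End(U)) : F :=
  \tr (mxof (vbasis fullv) (vbasis fullv) f).

Lemma lfun_trace_basis (e : (\dim {:U}).-tuple U) (f : 'End(U)) :
  basis_of {:U} e -> lfun_trace f = \tr (mxof e e f).
Proof.
move=> eB; have bB : basis_of {:U} (vbasis {:U}) by apply: vbasisP.
rewrite /lfun_trace -[f in LHS]comp_lfun1r (mxof_comp _ _ eB) mxtrace_mulC.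
by rewrite -(mxof_comp _ _ bB) comp_lfun1l.
Qed.

Definition lfun_rank (f : 'End(U)) : nat := \dim (limg f).

End LinearMaps.

(* A unitary space is a finite-dimensional space U over R[i] together with a
   form : {dot U for Num.conj}, linear in its first argument and
   conjugate-linear in its second. *)
Section UnitarySpace.
Variables (R : realType) (U : vectType R[i]).
Variable form : {dot U for @Num.conj R[i]}.

Definition unitary_operator (f : 'End(U)) : Prop :=
  limg f = fullv /\ isometry form form f.

Definition orthogonal_projection (f : 'End(U)) : Prop :=
  (f \o f)%VF = f /\
  (forall u v, u \in limg f -> v \in lker f -> form u v = 0).

Variables (m : nat) (G : {group 'S_m}).

(* In the group 'S_m, (s * t) p = t (s p), so s * t is the composite of t
   after s: the third clause maps composites of permutations to composites of
   operators in the same order.  Only the values of X on G matter. *)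
Definition unitary_representation (X : 'S_m -> 'End(U)) : Prop :=
  [/\ forall s, s \in G -> unitary_operator (X s),
      X 1%g = \1%VF
    & forall s t, s \in G -> t \in G -> X (s * t)%g = (X t \o X s)%VF].

Definition irreducible_representation (X : 'S_m -> 'End(U)) : Prop :=
  {:U}%VS <> 0%VS /\
  (forall W : {vspace U}, (forall s, s \in G -> (X s @: W <= W)%VS) ->
     W = 0%VS \/ W = fullv).

Definition rep_character (X : 'S_m -> 'End(U)) (s : 'S_m) : R[i] :=
  lfun_trace (X s).

Definition point_stabilizer (p : 'I_m) : {group 'S_m} := 'C_G[p | 'P]%G.

Definition stabilizer_mean (X : 'S_m -> 'End(U)) (p : 'I_m) : 'End(U) :=
  (#|point_stabilizer p|%:R : R[i])^-1 *: \sum_(s in point_stabilizer p) X s.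

End UnitarySpace.

(* Main.v *)
Require Import Defs.
From HB Require Import structures.
From mathcomp Require Import all_boot all_order all_algebra all_fingroup.
From mathcomp Require Import sesquilinear.
From mathcomp Require Import reals complex.

(** Averaging a representation X over a finite group H gives a map T whose
    image consists of H-fixed vectors: composing T with X s merely permutes the
    terms of the average ([comp_group_mean]).  Hence T fixes its image, that
    is, T is idempotent ([group_mean_idem]).

    Orthogonality of image and kernel uses the invariance of the inner product
    ([group_mean_orthogonal]): if u is fixed by H and T v = 0, then
    <u, v> = <X s u, X s v> = <u, X s v> for each s in H, and summing over s
    gives #|H| <u, v> = <u, #|H| T v> = 0.

    The rank formula holds because an idempotent has trace equal to its rank
    ([idempotent_trace]), while the trace of T is the average of the character
    by linearity.

    Both parts apply to any subgroup of G; the point stabilizer is the case at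
    hand. *)

Set Implicit Arguments.
Unset Strict Implicit.
Unset Printing Implicit Defensive.

Import GRing.Theory Num.Theory passmx.
Local Open Scope ring_scope.

Section Trace.
Variables (F : fieldType) (U : vectType F).

Lemma lfun_traceZ a (f : 'End(U)) : lfun_trace (a *: f) = a * lfun_trace f.
Proof. by rewrite /lfun_trace linearZ /= mxtraceZ. Qed.

Lemma lfun_trace_sum (I : Type) (r : seq I) (P : pred I) (f : I -> 'End(U)) :
  lfun_trace (\sum_(i <- r | P i) f i) = \sum_(i <- r | P i) lfun_trace (f i).
Proof. by rewrite /lfun_trace linear_sum raddf_sum. Qed.

Lemma lfun_trace1 : lfun_trace (\1%VF : 'End(U)) = (\dim {:U})%:R.
Proof.
by rewrite /lfun_trace mxof1 ?mxtrace1 // (basis_free (vbasisP _)).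
Qed.

Lemma lfun_trace_comp (V : vectType F) (f : 'Hom(U, V)) (g : 'Hom(V, U)) :
  lfun_trace (g \o f)%VF = lfun_trace (f \o g)%VF.
Proof.
rewrite /lfun_trace (mxof_comp _ _ (vbasisP {:V})) mxtrace_mulC.
by rewrite -(mxof_comp _ _ (vbasisP {:U})).
Qed.

End Trace.

(** An idempotent f factors through its image as the inclusion after the
    corestriction; composed in the other order these two maps give the identity
    of the image, whose trace is the dimension of the image. *)
Lemma idempotent_trace (F : fieldType) (U : vectType F) (f : 'End(U)) :
  (f \o f)%VF = f -> lfun_trace f = (lfun_rank f)%:R.
Proof.
move=> ff; set W := limg f.
pose h : 'Hom(U, subvs_of W) := linfun (vsproj W \o f).
pose g : 'Hom(subvs_of W, U) := linfun vsval.
have gh : (g \o h)%VF = f.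
  by apply/lfunP=> u; rewrite comp_lfunE !lfunE /= vsprojK ?memv_img ?memvf.
have hg : (h \o g)%VF = \1%VF.
  apply/lfunP=> w; apply: val_inj; rewrite comp_lfunE !lfunE /=.
  rewrite vsprojK ?memv_img ?memvf //.
  have /memv_imgP[u _ ->] : vsval w \in limg f by apply: subvsP.
  by rewrite -comp_lfunE ff.
by rewrite -[in LHS]gh lfun_trace_comp hg lfun_trace1 dimvf.
Qed.

Section GroupMean.
Variables (F : fieldType) (U : vectType F) (gT : finGroupType).
Variables (H : {group gT}) (X : gT -> 'End(U)).

Definition group_mean : 'End(U) := (#|H|%:R : F)^-1 *: \sum_(s in H) X s.

Lemma trace_group_mean :
  lfun_trace group_mean = #|H|%:R^-1 * \sum_(s in H) lfun_trace (X s).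
Proof. by rewrite lfun_traceZ lfun_trace_sum. Qed.

Hypothesis X_comp :
  forall s t, s \in H -> t \in H -> X (s * t)%g = (X t \o X s)%VF.

(** Right translation by s permutes H, hence the terms of the average. *)
Lemma comp_group_mean s : s \in H -> (X s \o group_mean)%VF = group_mean.
Proof.
move=> sH; apply/lfunP=> u; rewrite comp_lfunE !scale_lfunE linearZ /=.
congr (_ *: _); rewrite !sum_lfunE linear_sum [RHS](reindex_inj (mulIg s)) /=.
apply: eq_big => [t | t tH]; first by rewrite groupMr.
by rewrite X_comp // comp_lfunE.
Qed.

Hypothesis H_neq0 : (#|H|%:R : F) != 0.

Lemma group_mean_idem : (group_mean \o group_mean)%VF = group_mean.
Proof.
apply/lfunP=> u; rewrite comp_lfunE [in LHS]scale_lfunE sum_lfunE.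
under eq_bigr => s sH do rewrite -comp_lfunE comp_group_mean //.
by rewrite sumr_const -scaler_nat scalerA mulVf // scale1r.
Qed.

End GroupMean.

Lemma group_mean_orthogonal (R : realType) (U : vectType R[i])
    (form : {dot U for @Num.conj R[i]}) (gT : finGroupType) (H : {group gT})
    (X : gT -> 'End(U)) :
    (forall s t, s \in H -> t \in H -> X (s * t)%g = (X t \o X s)%VF) ->
    (forall s, s \in H -> isometry form form (X s)) ->
  forall u v, u \in limg (group_mean H X) -> v \in lker (group_mean H X) ->
  form u v = 0.
Proof.
move=> X_comp X_iso _ v /memv_imgP[u _ ->].
have H_neq0 : (#|H|%:R : R[i]) != 0 by rewrite pnatr_eq0 -lt0n cardG_gt0.
rewrite memv_ker scale_lfunE scaler_eq0 invr_eq0 (negPf H_neq0) /= sum_lfunE.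
move/eqP=> sumXv0; apply: (mulfI H_neq0); rewrite mulr0 mulr_natl -sumr_const.
rewrite -[RHS](linear0r form (group_mean H X u)) -sumXv0 linear_sumr.
apply: eq_bigr => s sH.
by rewrite -(X_iso s sH) -comp_lfunE comp_group_mean.
Qed.

Theorem theorem1p7 (R : realType) (m : nat) (G : {group 'S_m})
    (U : vectType R[i]) (form : {dot U for @Num.conj R[i]})
    (X : 'S_m -> 'End(U))
    (X_rep : unitary_representation form G X)
    (X_irr : irreducible_representation G X)
    (p : 'I_m) :
  orthogonal_projection form (stabilizer_mean G X p) /\
  (lfun_rank (stabilizer_mean G X p))%:R =
    (#|point_stabilizer G p|%:R)^-1 *
      \sum_(s in point_stabilizer G p) rep_character X s.
Proof.
have [X_unitary _ X_comp] := X_rep.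
set H := point_stabilizer G p.
have HG s : s \in H -> s \in G by case/setIP.
have H_comp s t : s \in H -> t \in H -> X (s * t)%g = (X t \o X s)%VF.
  by move=> /HG sG /HG; apply: X_comp.
have H_neq0 : (#|H|%:R : R[i]) != 0 by rewrite pnatr_eq0 -lt0n cardG_gt0.
rewrite -[stabilizer_mean G X p]/(group_mean H X).
have T_idem := group_mean_idem H_comp H_neq0.
split; last by rewrite -idempotent_trace // trace_group_mean.
split=> //; apply: group_mean_orthogonal => // s /HG sG.
exact: (X_unitary s sG).2.
Qed.
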